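(* Let $R$ be a commutative ring with unit containing $\mathbb{Q}$, let $n\ge 1$, and let $F=(F_i)_{1\le i\le n}$ and $G=(G_i)_{1\le i\le n}$ be two systems of formal power series in $R[[X_1,\ldots,X_n]]$ without constant term. For any $d\ge 1$ and any $i,j_1,\ldots,j_d\in\{1,\ldots,n\}$, $$(F\circ G)^{[d]}_{i,j_1\ldots j_d}=\int d\bar s\,ds\,d\bar t\,dt\,d\bar u\,du\ e^{-\bar s s-\bar t t-\bar u u}\ U,$$ where $$U=s_i\,\bar u_{j_1}\cdots\bar u_{j_d}\,\exp\left(\bar sF(t)+\bar tG(u)\right),$$ the integral being the formal Gaussian integral with all three covariances equal to the identity matrix, and $$(F\circ G)^{[d]}_{i,j_1\ldots j_d}=\left.\frac{\partial^d}{\partial X_{j_1}\cdots\partial X_{j_d}}\right|_{X=0}F_i(G(X)).$$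
   Context: Write $[k]=\{1,\ldots,k\}$. $\bar s,s,\bar t,t,\bar u,u$ are six vectors of $n$ indeterminates each (e.g. $\bar s=(\bar s_1,\ldots,\bar s_n)$), and $K=R[[\bar s,s,\bar t,t,\bar u,u]]$. Put $\bar sF(t)=\sum_{i=1}^n\bar s_iF_i(t_1,\ldots,t_n)$ and $\bar tG(u)=\sum_{i=1}^n\bar t_iG_i(u_1,\ldots,u_n)$; these have no constant term, so $\exp(\bar sF(t)+\bar tG(u))\in K$. Formal Gaussian integral (identity covariances). For maps $\tau_r:[k_r]\to[n]$, $1\le r\le 6$, set $$I(\tau_1,\ldots,\tau_6)=\sum_{\sigma,\mu,\nu}\Big(\prod_{k=1}^{k_1}\delta_{\tau_2(\sigma(k))\,\tau_1(k)}\Big)\Big(\prod_{k=1}^{k_3}\delta_{\tau_4(\mu(k))\,\tau_3(k)}\Big)\Big(\prod_{k=1}^{k_5}\delta_{\tau_6(\nu(k))\,\tau_5(k)}\Big),$$ the sum being over all bijections $\sigma:[k_1]\to[k_2]$, $\mu:[k_3]\to[k_4]$, $\nu:[k_5]\to[k_6]$ (so it is $0$ unless $k_1=k_2$, $k_3=k_4$, $k_5=k_6$); $\delta$ is Kronecker's symbol. For multiindices $\alpha_1,\ldots,\alpha_6\in\mathbb{N}^n$, the formal Gaussian integral $$\int d\bar s\,ds\,d\bar t\,dt\,d\bar u\,du\ e^{-\bar s s-\bar t t-\bar u u}\ \bar s^{\alpha_1}s^{\alpha_2}\bar t^{\alpha_3}t^{\alpha_4}\bar u^{\alpha_5}u^{\alpha_6}$$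 is defined to be $I(\tau_1,\ldots,\tau_6)\in R$, where $\tau_r:[|\alpha_r|]\to[n]$ is any map taking each value $i\in[n]$ exactly $(\alpha_r)_i$ times (the result does not depend on the choice). For a general $U\in K$, the integral is the sum over all monomials of (coefficient of the monomial in $U$) times (integral of the monomial), defined when only finitely many terms of this sum are nonzero. The symbol $\int\cdots e^{-\bar ss-\bar tt-\bar uu}$ is only notation for this. *)

(* Defs.v *)
(* Power series are coefficient functions on the monomials ['X_{1..n}] of the
   multinomials library; [boolp] provides functional extensionality and the
   choiceType structure on power series. *)
From HB Require Import structures.
From mathcomp Require Import all_boot all_order all_algebra.
From mathcomp Require Import perm boolp.
From mathcomp Require Import mpoly.

Set Implicit Arguments.
Unset Strict Implicit.
Unset Printing Implicit Defensive.

Import GRing.Theory.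
Local Open Scope ring_scope.

(* [f m] is the coefficient of the monomial [m] in [f]. *)
Record fps (R : Type) (n : nat) := FPS { fps_coef :> 'X_{1..n} -> R }.

HB.instance Definition _ (R : Type) (n : nat) := gen_eqMixin (fps R n).
HB.instance Definition _ (R : Type) (n : nat) := gen_choiceMixin (fps R n).

Lemma fpsP (R : Type) (n : nat) (f g : fps R n) : f =1 g -> f = g.
Proof. by case: f g => f [g] /= fg; congr FPS; apply/funext. Qed.

Section FpsRing.
Variables (R : comNzRingType) (n : nat).
Implicit Types f g h : fps R n.

Definition fps_zero : fps R n := FPS (fun=> 0).
Definition fps_opp f : fps R n := FPS (fun m => - f m).
Definition fps_add f g : fps R n := FPS (fun m => f m + g m).
Definition fps_one : fps R n := FPS (fun m => (m == 0%MM)%:R).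

(* The Cauchy product, as in [mcoeffM]. *)
Definition fps_mul f g : fps R n := FPS (fun m =>
  \sum_(k : 'X_{1..n < (mdeg m).+1, (mdeg m).+1} | m == (k.1 + k.2)%MM)
     f k.1 * g k.2).

Lemma fps_addA : associative fps_add.
Proof. by move=> f g h; apply: fpsP => m /=; rewrite addrA. Qed.
Lemma fps_addC : commutative fps_add.
Proof. by move=> f g; apply: fpsP => m /=; rewrite addrC. Qed.
Lemma fps_add0 : left_id fps_zero fps_add.
Proof. by move=> f; apply: fpsP => m /=; rewrite add0r. Qed.
Lemma fps_addN : left_inverse fps_zero fps_opp fps_add.
Proof. by move=> f; apply: fpsP => m /=; rewrite addNr. Qed.

HB.instance Definition _ :=
  GRing.isZmodule.Build (fps R n) fps_addA fps_addC fps_add0 fps_addN.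

Definition fps_trunc (d : nat) f : {mpoly R[n]} :=
  \sum_(m : 'X_{1..n < d}) f m *: 'X_[m].

Lemma mcoeff_fps_trunc d f (m : 'X_{1..n}) :
  (mdeg m < d)%N -> (fps_trunc d f)@_m = f m.
Proof.
move=> lt_md; rewrite raddf_sum /= (bigD1 (BMultinom lt_md)) //=.
rewrite mcoeffZ mcoeffX eqxx mulr1 big1 ?addr0 // => k /negPf ne_km.
by rewrite mcoeffZ mcoeffX -[_ == m]/(val k == val (BMultinom lt_md))
           val_eqE ne_km mulr0.
Qed.

Lemma eq_mcoeffM (p p' q q' : {mpoly R[n]}) (m : 'X_{1..n}) :
  (forall k, (mdeg k <= mdeg m)%N -> p@_k = p'@_k) ->
  (forall k, (mdeg k <= mdeg m)%N -> q@_k = q'@_k) ->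
  (p * q)@_m = (p' * q')@_m.
Proof.
move=> hp hq; rewrite !mcoeffM; apply: eq_bigr => -[k1 k2] /= _.
by rewrite hp ?hq // -ltnS bmdeg.
Qed.

Lemma fps_mul_trunc d f g (m : 'X_{1..n}) : (mdeg m < d)%N ->
  fps_mul f g m = (fps_trunc d f * fps_trunc d g)@_m.
Proof.
move=> lt_md; rewrite mcoeffM; apply: eq_bigr => -[k1 k2] /= _.
by rewrite !mcoeff_fps_trunc // (leq_trans _ lt_md) // bmdeg.
Qed.

Lemma fps_mulA : associative fps_mul.
Proof.
move=> f g h; apply: fpsP => m; pose d := (mdeg m).+1.
transitivity ((fps_trunc d f * fps_trunc d g * fps_trunc d h)@_m).
  rewrite -mulrA (@fps_mul_trunc d) //; apply: eq_mcoeffM => // k le_km.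
  by rewrite mcoeff_fps_trunc // (@fps_mul_trunc d).
rewrite (@fps_mul_trunc d) //; apply: eq_mcoeffM => // k le_km.
by rewrite mcoeff_fps_trunc // (@fps_mul_trunc d).
Qed.

Lemma fps_mulC : commutative fps_mul.
Proof.
by move=> f g; apply: fpsP => m; rewrite !(@fps_mul_trunc (mdeg m).+1) // mulrC.
Qed.

Lemma fps_mul1 : left_id fps_one fps_mul.
Proof.
move=> f; apply: fpsP => m; rewrite (@fps_mul_trunc (mdeg m).+1) //.
rewrite -[RHS](@mcoeff_fps_trunc (mdeg m).+1) // -[in RHS](mul1r (fps_trunc _ _)).
by apply: eq_mcoeffM => // k le_km; rewrite mcoeff_fps_trunc // mcoeff1.
Qed.

Lemma fps_mulDl : left_distributive fps_mul fps_add.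
Proof.
move=> f g h; apply: fpsP => m /=; rewrite -big_split /=.
by apply: eq_bigr => k _; rewrite mulrDl.
Qed.

Lemma fps_one_neq0 : fps_one != fps_zero.
Proof.
apply/eqP => /(congr1 (fun f : fps R n => f 0%MM)) /= /eqP.
by rewrite eqxx oner_eq0.
Qed.

HB.instance Definition _ := GRing.Zmodule_isComNzRing.Build (fps R n)
  fps_mulA fps_mulC fps_mul1 fps_mulDl fps_one_neq0.

Definition fpsX (i : 'I_n) : fps R n := FPS (fun m => (m == U_(i)%MM)%:R).

Definition fps_deriv (i : 'I_n) f : fps R n :=
  FPS (fun m => f (m + U_(i))%MM *+ (m i).+1).

Lemma fps_coefM_eq0 f g d e :
  (forall m, (mdeg m < d)%N -> f m = 0) ->
  (forall m, (mdeg m < e)%N -> g m = 0) ->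
  forall m, (mdeg m < d + e)%N -> (f * g) m = 0.
Proof.
move=> f0 g0 m; rewrite [(f * g) m]/(fps_mul f g m) /= => lt_m.
apply: big1 => -[k1 k2] /= /eqP def_m; have [lt_k1|le_k1] := ltnP (mdeg k1) d.
  by rewrite f0 ?mul0r.
have /eqP mE := congr1 (@mdeg n) def_m; rewrite mdegD eqn_leq in mE.
rewrite g0 ?mulr0 // -(ltn_add2l d) (leq_ltn_trans _ lt_m) //.
by case/andP: mE => _; apply: leq_trans; rewrite leq_add2r.
Qed.

Lemma fps_coefX_eq0 f k (m : 'X_{1..n}) :
  f 0%MM = 0 -> (mdeg m < k)%N -> (f ^+ k) m = 0.
Proof.
move=> f0; elim: k m => // k IHk m; rewrite exprS.
apply: (@fps_coefM_eq0 _ _ 1) => // m'.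
by rewrite ltnS leqn0 mdeg_eq0 => /eqP ->.
Qed.

End FpsRing.

Arguments fpsX {R n} i.

Lemma fps_coef_prodX_eq0 (R : comNzRingType) (n p : nat) (G : 'I_n -> fps R p)
    (a : 'X_{1..n}) (m : 'X_{1..p}) :
  (forall i, G i 0%MM = 0) -> (mdeg m < mdeg a)%N ->
  (\prod_(i < n) G i ^+ a i) m = 0.
Proof.
move=> G0; rewrite [mdeg a]mdegE; move: m.
pose K (f : fps R p) (d : nat) := forall m, (mdeg m < d)%N -> f m = 0.
rewrite -/(K _ _); apply: (big_rec2 K) => // i f d _ IH m.
by apply: fps_coefM_eq0 => // m'; apply: fps_coefX_eq0.
Qed.

(* Substitution [F(G_1, .., G_n)] for [G_i] without constant term: by
   [fps_coef_prodX_eq0], a monomial of degree greater than [mdeg m] of [F] does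
   not contribute to the coefficient of [m].  No meaning is intended when some
   [G_i] has a constant term. *)
Definition fps_subst (R : comNzRingType) (n p : nat)
    (F : fps R n) (G : 'I_n -> fps R p) : fps R p :=
  FPS (fun m => \sum_(a : 'X_{1..n < (mdeg m).+1})
                   F a * (\prod_(i < n) G i ^+ a i) m).

(* The exponential of a series [A] without constant term: [A ^+ k] contributes
   to the coefficient of [m] only if [k <= mdeg m], by [fps_coefX_eq0].  No
   meaning is intended when [A] has a constant term. *)
Definition fps_exp (R : comAlgType rat) (n : nat) (A : fps R n) : fps R n :=
  FPS (fun m => \sum_(k < (mdeg m).+1) ((k`!)%:R^-1 : rat) *: (A ^+ k) m).


Definition fps_derivs (R : comNzRingType) (n : nat) (js : seq 'I_n)
    (f : fps R n) : fps R n :=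
  foldr (fun j g => fps_deriv j g) f js.

Definition bijectiveb (aT rT : finType) (f : aT -> rT) : bool :=
  injectiveb f && [forall y, y \in codom f].

Lemma bijectiveP (aT rT : finType) (f : aT -> rT) :
  reflect (bijective f) (bijectiveb f).
Proof.
apply: (iffP andP) => [[/injectiveP f_inj /forallP f_surj]|f_bij].
  by exists (fun y => iinv (f_surj y)) => x; [apply: f_inj|]; rewrite f_iinv.
split; first by apply/injectiveP; apply: bij_inj.
by apply/forallP => y; have [g _ gK] := f_bij; rewrite -(gK y) codom_f.
Qed.

Definition gaussI (R : comNzRingType) (n k1 k2 k3 k4 k5 k6 : nat)
    (tau1 : 'I_k1 -> 'I_n) (tau2 : 'I_k2 -> 'I_n) (tau3 : 'I_k3 -> 'I_n)
    (tau4 : 'I_k4 -> 'I_n) (tau5 : 'I_k5 -> 'I_n) (tau6 : 'I_k6 -> 'I_n) : R :=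
  \sum_(sigma : {ffun 'I_k1 -> 'I_k2} | bijectiveb sigma)
  \sum_(mu : {ffun 'I_k3 -> 'I_k4} | bijectiveb mu)
  \sum_(nu : {ffun 'I_k5 -> 'I_k6} | bijectiveb nu)
    (\prod_(k < k1) (tau2 (sigma k) == tau1 k)%:R) *
    (\prod_(k < k3) (tau4 (mu k) == tau3 k)%:R) *
    (\prod_(k < k5) (tau6 (nu k) == tau5 k)%:R).

(* [m2s a] is the nondecreasing sequence in which each [i] occurs [a i] times. *)
Definition multi_map (n : nat) (a : 'X_{1..n}) : 'I_(size (m2s a)) -> 'I_n :=
  tnth (in_tuple (m2s a)).
Arguments multi_map {n} a k.

(* The integral of a monomial, computed from one particular choice of the maps;
   [gauss_monomialE] shows that the choice is irrelevant. *)
Definition gauss_monomial (R : comNzRingType) (n : nat)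
    (a1 a2 a3 a4 a5 a6 : 'X_{1..n}) : R :=
  gaussI R (multi_map a1) (multi_map a2) (multi_map a3)
           (multi_map a4) (multi_map a5) (multi_map a6).

Section ChoiceIndependence.
Variables (R : comNzRingType) (n : nat).

Definition wick k1 k2 (tau1 : 'I_k1 -> 'I_n) (tau2 : 'I_k2 -> 'I_n) : R :=
  \sum_(sigma : {ffun 'I_k1 -> 'I_k2} | bijectiveb sigma)
    \prod_(k < k1) (tau2 (sigma k) == tau1 k)%:R.

Lemma gaussI_wick k1 k2 k3 k4 k5 k6
    (tau1 : 'I_k1 -> 'I_n) (tau2 : 'I_k2 -> 'I_n) (tau3 : 'I_k3 -> 'I_n)
    (tau4 : 'I_k4 -> 'I_n) (tau5 : 'I_k5 -> 'I_n) (tau6 : 'I_k6 -> 'I_n) :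
  gaussI R tau1 tau2 tau3 tau4 tau5 tau6 =
    wick tau1 tau2 * wick tau3 tau4 * wick tau5 tau6.
Proof.
rewrite /gaussI -mulrA mulr_suml; apply: eq_bigr => sigma _.
rewrite mulr_suml mulr_sumr; apply: eq_bigr => mu _.
by rewrite mulr_sumr mulr_sumr; apply: eq_bigr => nu _; rewrite mulrA.
Qed.

Lemma wick_bij k1 k2 l1 l2 (tau1 : 'I_k1 -> 'I_n) (tau2 : 'I_k2 -> 'I_n)
    (h1 : 'I_l1 -> 'I_k1) (h2 : 'I_l2 -> 'I_k2) :
  bijective h1 -> bijective h2 ->
  wick (tau1 \o h1) (tau2 \o h2) = wick tau1 tau2.
Proof.
move=> h1_bij h2_bij; have [g1 h1K g1K] := h1_bij; have [g2 h2K g2K] := h2_bij.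
pose conj (s : {ffun 'I_l1 -> 'I_l2}) := [ffun k => h2 (s (g1 k))].
pose conj' (s : {ffun 'I_k1 -> 'I_k2}) := [ffun k => g2 (s (h1 k))].
have conjK : cancel conj conj'.
  by move=> s; apply/ffunP => k; rewrite !ffunE h1K h2K.
have conj'K : cancel conj' conj.
  by move=> s; apply/ffunP => k; rewrite !ffunE g1K g2K.
rewrite /wick [RHS](reindex conj) /=; last by exists conj' => s _.
apply: eq_big => [s|s _].
  have sE : conj s =1 h2 \o (s \o g1) by move=> k; rewrite ffunE.
  have g1_bij : bijective g1 by exists h1.
  have g2_bij : bijective g2 by exists h2.
  apply/bijectiveP/bijectiveP => s_bij.
    by apply: eq_bij (fsym sE); do !apply: bij_comp => //.
  have : bijective (g2 \o (conj s \o h1)) by do !apply: bij_comp => //.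
  by move/eq_bij; apply=> k /=; rewrite sE /= h1K h2K.
rewrite [RHS](reindex h1) /=; last exact: onW_bij.
by apply: eq_bigr => k _; rewrite ffunE h1K.
Qed.

Lemma multi_mapP k (tau : 'I_k -> 'I_n) (a : 'X_{1..n}) :
  (forall i, #|[pred x | tau x == i]| = a i) ->
  exists2 h, bijective h & tau =1 multi_map a \o h.
Proof.
move=> tauP; have pt : perm_eq [tuple tau x | x < k] (m2s a).
  apply/allP => i _ /=; apply/eqP.
  transitivity (a i); last by rewrite -[in LHS](s2mK a) mnmE.
  rewrite -tauP /= count_map -sum1_count -sum1_card.
  by rewrite big_enum_cond.
have szk : size (m2s a) = k by rewrite -(perm_size pt) size_tuple.
have /tuple_permP[p pE] : perm_eq [tuple tau x | x < k] (Tuple (introT eqP szk)).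
  by [].
exists (fun x => cast_ord (esym szk) (p x)) => [|x].
  exists (fun y => (p^-1)%g (cast_ord szk y)) => [x|y].
    by rewrite cast_ordKV permK.
  by rewrite permKV cast_ordK.
have /val_inj/(congr1 (fun t : k.-tuple 'I_n => tnth t x)) := pE.
by rewrite !tnth_mktuple /= /multi_map !(tnth_nth (tau x)).
Qed.

Lemma gauss_monomialE k1 k2 k3 k4 k5 k6
    (tau1 : 'I_k1 -> 'I_n) (tau2 : 'I_k2 -> 'I_n) (tau3 : 'I_k3 -> 'I_n)
    (tau4 : 'I_k4 -> 'I_n) (tau5 : 'I_k5 -> 'I_n) (tau6 : 'I_k6 -> 'I_n)
    (a1 a2 a3 a4 a5 a6 : 'X_{1..n}) :
  (forall i, #|[pred x | tau1 x == i]| = a1 i) ->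
  (forall i, #|[pred x | tau2 x == i]| = a2 i) ->
  (forall i, #|[pred x | tau3 x == i]| = a3 i) ->
  (forall i, #|[pred x | tau4 x == i]| = a4 i) ->
  (forall i, #|[pred x | tau5 x == i]| = a5 i) ->
  (forall i, #|[pred x | tau6 x == i]| = a6 i) ->
  gauss_monomial R a1 a2 a3 a4 a5 a6 = gaussI R tau1 tau2 tau3 tau4 tau5 tau6.
Proof.
move=> /multi_mapP[h1 b1 /funext->] /multi_mapP[h2 b2 /funext->].
move=> /multi_mapP[h3 b3 /funext->] /multi_mapP[h4 b4 /funext->].
move=> /multi_mapP[h5 b5 /funext->] /multi_mapP[h6 b6 /funext->].
by rewrite /gauss_monomial !gaussI_wick !wick_bij.
Qed.

End ChoiceIndependence.

(* The six vectors sbar, s, tbar, t, ubar, u, in this order: the [i]-th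
   component of the [r]-th vector is the indeterminate of index [gidx r i]. *)
Definition gidx (n : nat) (r : 'I_6) (i : 'I_n) : 'I_(6 * n) := mxvec_index r i.

Definition i_sbar : 'I_6 := @Ordinal 6 0 isT.
Definition i_s    : 'I_6 := @Ordinal 6 1 isT.
Definition i_tbar : 'I_6 := @Ordinal 6 2 isT.
Definition i_t    : 'I_6 := @Ordinal 6 3 isT.
Definition i_ubar : 'I_6 := @Ordinal 6 4 isT.
Definition i_u    : 'I_6 := @Ordinal 6 5 isT.

Section Indeterminates.
Variables (R : comNzRingType) (n : nat) (i : 'I_n).
Definition v_sbar : fps R (6 * n) := fpsX (gidx i_sbar i).
Definition v_s    : fps R (6 * n) := fpsX (gidx i_s i).
Definition v_tbar : fps R (6 * n) := fpsX (gidx i_tbar i).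
Definition v_t    : fps R (6 * n) := fpsX (gidx i_t i).
Definition v_ubar : fps R (6 * n) := fpsX (gidx i_ubar i).
Definition v_u    : fps R (6 * n) := fpsX (gidx i_u i).
End Indeterminates.
Arguments v_sbar R {n} i.
Arguments v_s R {n} i.
Arguments v_tbar R {n} i.
Arguments v_t R {n} i.
Arguments v_ubar R {n} i.
Arguments v_u R {n} i.

Definition block (n : nat) (r : 'I_6) (m : 'X_{1..6 * n}) : 'X_{1..n} :=
  [multinom m (gidx r i) | i < n].

Definition gauss_term (R : comNzRingType) (n : nat)
    (U : fps R (6 * n)) (m : 'X_{1..6 * n}) : R :=
  U m * gauss_monomial R (block i_sbar m) (block i_s m) (block i_tbar m)
                         (block i_t m) (block i_ubar m) (block i_u m).

(* Definedness (finitely many nonzero terms) is part of the relation. *)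
Definition is_gauss_integral (R : comNzRingType) (n : nat)
    (U : fps R (6 * n)) (v : R) : Prop :=
  exists S : seq 'X_{1..6 * n},
    [/\ uniq S, forall m, gauss_term U m != 0 -> m \in S
      & v = \sum_(m <- S) gauss_term U m].

Lemma is_gauss_integral_unique (R : comNzRingType) (n : nat)
    (U : fps R (6 * n)) (v w : R) :
  is_gauss_integral U v -> is_gauss_integral U w -> v = w.
Proof.
move=> [S [uS supS ->]] [T [uT supT ->]].
have E (A : seq 'X_{1..6 * n}) : \sum_(m <- A) gauss_term U m
    = \sum_(m <- [seq m <- A | gauss_term U m != 0]) gauss_term U m.
  by rewrite big_filter [RHS]big_mkcond; apply: eq_bigr => m _; case: eqP.
rewrite E [RHS]E; apply: perm_big; apply: uniq_perm; rewrite ?filter_uniq // => m.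
rewrite !mem_filter; case: (boolP (gauss_term U m != 0)) => //= nz.
by rewrite supS ?supT.
Qed.

(* Main.v *)
(* Write [alpha], [beta] for exponents of [sbar], [tbar] and [A] for
   [sbar F(t) + tbar G(u)].  Since [A] is linear in the bars, differentiating
   [exp A] along [sbar^alpha tbar^beta] multiplies it by [F(t)^alpha G(u)^beta],
   and [exp A] is [1] where the bars vanish; so [alpha! beta!] times the
   coefficient of [sbar^alpha tbar^beta] in [exp A] is [F(t)^alpha G(u)^beta].
   The integral of a monomial vanishes unless paired exponents agree, and is
   then the product of their factorials.  The factors [s_i] and [ubar^J] of the
   integrand force [alpha = e_i] and the exponent [J] for [u], and only
     [sum_beta F_i,beta [G^beta]_J J! = J! [F_i(G)]_J]
   is left, where the terms with [|beta| > |J|] vanish. *)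
Require Import Defs.
From mathcomp Require Import all_boot all_order all_algebra.
From mathcomp Require Import perm.
From mathcomp Require Import mpoly.

Set Implicit Arguments.
Unset Strict Implicit.
Unset Printing Implicit Defensive.

Import GRing.Theory.
Local Open Scope ring_scope.

(** * Coefficients of products, monomials and derivatives of power series *)

Section FpsCoefficients.
Variables (R : comNzRingType) (n : nat).
Implicit Types (f g h : fps R n) (a b m : 'X_{1..n}).

Lemma fps_coef0 m : (0 : fps R n) m = 0. Proof. by []. Qed.

Lemma fps_coef1 m : (1 : fps R n) m = (m == 0%MM)%:R. Proof. by []. Qed.

Lemma fps_coefD f g m : (f + g) m = f m + g m. Proof. by []. Qed.

Lemma fps_coef_sum (I : Type) (r : seq I) (P : pred I) (f : I -> fps R n) m :
  (\sum_(i <- r | P i) f i) m = \sum_(i <- r | P i) f i m.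
Proof. exact: (big_morph (fun h : fps R n => h m)). Qed.

Lemma fps_coefMn f k m : (f *+ k) m = f m *+ k.
Proof.
by elim: k => [|k IHk]; rewrite ?mulr0n // !mulrS fps_coefD IHk.
Qed.

Lemma fps_coefM f g m : (f * g) m =
  \sum_(k : 'X_{1..n < (mdeg m).+1, (mdeg m).+1} | m == (k.1 + k.2)%MM)
     f k.1 * g k.2.
Proof. by []. Qed.

(** The Cauchy product at [m] only sees degrees up to [mdeg m], so [f] and [g] may be replaced by
    polynomials agreeing with them there. This carries polynomial identities over to series. *)
Lemma fps_coefM_mpoly f g (p q : {mpoly R[n]}) m :
  (forall k, (mdeg k <= mdeg m)%N -> f k = p@_k) ->
  (forall k, (mdeg k <= mdeg m)%N -> g k = q@_k) ->
  (f * g) m = (p * q)@_m.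
Proof.
move=> fp gq; rewrite [LHS](@fps_mul_trunc _ _ (mdeg m).+1) //.
by apply: eq_mcoeffM => k le_km; rewrite mcoeff_fps_trunc ?fp ?gq.
Qed.

Lemma eq_fps_coefM f f' g g' m :
  (forall a b, m = (a + b)%MM -> f a * g b = f' a * g' b) ->
  (f * g) m = (f' * g') m.
Proof. by move=> E; rewrite !fps_coefM; apply: eq_bigr => k /eqP /E. Qed.

Lemma fps_coefM_split0 f g m :
  (forall a b, m = (a + b)%MM -> f a * g b = 0) -> (f * g) m = 0.
Proof. by move=> E; rewrite fps_coefM big1 // => k /eqP /E. Qed.

(** For factors with sparse support, one splitting of the monomial carries the whole Cauchy sum. *)
Lemma fps_coefM_unique_split f g a b :
  (forall a' b', (a + b = a' + b')%MM -> a' != a -> f a' * g b' = 0) ->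
  (f * g) (a + b)%MM = f a * g b.
Proof.
move=> E; have lt_a : (mdeg a < (mdeg (a + b)).+1)%N by rewrite mdegD ltnS leq_addr.
have lt_b : (mdeg b < (mdeg (a + b)).+1)%N by rewrite mdegD ltnS leq_addl.
rewrite fps_coefM (bigD1 (BMultinom lt_a, BMultinom lt_b)) //= big1 ?addr0 //.
move=> [[a' lt_a'] [b' lt_b']] /= /andP[/eqP Eab ne_ab]; apply: E => //.
apply: contraNneq ne_ab => Ea; have Eb : b = b' by apply: (@addmI _ a); rewrite Eab Ea.
by rewrite xpair_eqE -!val_eqE /= Ea Eb !eqxx.
Qed.

Definition fps_monom a : fps R n := FPS (fun m => (m == a)%:R).

Lemma fps_monomM a f m :
  (fps_monom a * f) m = if (a <= m)%MM then f (m - a)%MM else 0.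
Proof.
case: ifPn => [le_am|nle_am].
  rewrite -[in LHS](submK le_am) addmC fps_coefM_unique_split /= ?eqxx ?mul1r //.
  move=> a' b' _.
  by move/negPf->; rewrite mul0r.
apply: fps_coefM_split0 => a' b' Em /=; case: eqP => [Ea|]; last by rewrite mul0r.
by case/negP: nle_am; rewrite Em Ea lem_addr.
Qed.

Lemma fps_monom0 : fps_monom 0%MM = 1. Proof. by []. Qed.

Lemma fps_monomD a b : fps_monom (a + b) = fps_monom a * fps_monom b.
Proof.
apply: fpsP => m; rewrite fps_monomM; case: ifPn => [le_am|nle_am] /=.
  by rewrite -{1}(submK le_am) addmC eqm_add2l.
by case: eqP => // Em; case/negP: nle_am; rewrite Em lem_addr.
Qed.

Lemma fps_monom_muln a k : fps_monom (a *+ k) = fps_monom a ^+ k.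
Proof.
elim: k => [|k IHk]; first by rewrite expr0 -fps_monom0.
by rewrite mulmS fps_monomD IHk exprS.
Qed.

Lemma fps_monom_sum (I : Type) (r : seq I) (P : pred I) (a : I -> 'X_{1..n}) :
  fps_monom (\sum_(i <- r | P i) a i)%MM = \prod_(i <- r | P i) fps_monom (a i).
Proof. exact: (big_morph fps_monom fps_monomD fps_monom0). Qed.

Lemma fps_derivD i : {morph @fps_deriv R n i : f g / f + g}.
Proof. by move=> f g; apply: fpsP => m /=; rewrite mulrnDl. Qed.

Lemma fps_deriv0 i : fps_deriv i (0 : fps R n) = 0.
Proof. by apply: fpsP => m /=; rewrite mul0rn. Qed.

Lemma fps_deriv_sum i (I : Type) (r : seq I) (P : pred I) (f : I -> fps R n) :
  fps_deriv i (\sum_(k <- r | P k) f k) = \sum_(k <- r | P k) fps_deriv i (f k).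
Proof. exact: (big_morph (fps_deriv i) (fps_derivD i) (fps_deriv0 i)). Qed.

Lemma fps_derivM i f g :
  fps_deriv i (f * g) = fps_deriv i f * g + f * fps_deriv i g.
Proof.
(* Differentiation reads the coefficient at [m + U_(i)], of degree [mdeg m + 1]; truncating strictly
   below [mdeg m + 2] still keeps it. *)
apply: fpsP => m; pose d := (mdeg m).+2; pose p := fps_trunc d f.
pose q := fps_trunc d g; have deg1 k : mdeg (k + U_(i)) = (mdeg k).+1.
  by rewrite mdegD mdeg1 addn1.
rewrite fps_coefD -[LHS]/((f * g) (m + U_(i))%MM *+ (m i).+1).
rewrite (@fps_coefM_mpoly _ _ p q); last 2 first.
- by move=> k le_k; rewrite mcoeff_fps_trunc // /d ltnS -deg1.
- by move=> k le_k; rewrite mcoeff_fps_trunc // /d ltnS -deg1.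
rewrite -mcoeff_deriv mderivM mcoeffD; congr (_ + _); apply/esym.
  apply: fps_coefM_mpoly => k le_k.
    by rewrite /= mcoeff_deriv mcoeff_fps_trunc // deg1 !ltnS.
  by rewrite mcoeff_fps_trunc // ltnS leqW.
apply: fps_coefM_mpoly => k le_k; first by rewrite mcoeff_fps_trunc // ltnS leqW.
by rewrite /= mcoeff_deriv mcoeff_fps_trunc // deg1 !ltnS.
Qed.

Lemma fps_deriv1 i : fps_deriv i (1 : fps R n) = 0.
Proof. by apply: fpsP => m /=; rewrite mnmD_eq0 mnm1_eq0 andbF mul0rn. Qed.

Lemma fps_derivX i f k :
  fps_deriv i (f ^+ k.+1) = (f ^+ k * fps_deriv i f) *+ k.+1.
Proof.
elim: k => [|k IHk]; first by rewrite expr1 expr0 mul1r.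
rewrite exprS fps_derivM IHk -mulrnAr mulrA -exprS [_ * f ^+ _]mulrC.
by rewrite -mulrnAr -mulrDr -mulrS mulrnAr.
Qed.

Lemma fps_deriv_fpsX i k : fps_deriv i (fpsX k : fps R n) = (k == i)%:R.
Proof.
apply: fpsP => m /=; have [->|ne_ki] := eqVneq k i.
  rewrite fps_coef1 -[X in _ == X]add0m eqm_add2r.
  by case: eqP => [->|_]; rewrite ?mnm0E ?mul0rn.
rewrite fps_coef0; case: eqP => [/mnmP/(_ i)|_]; last by rewrite mul0rn.
by rewrite mnmDE !mnm1E eqxx (negPf ne_ki) addn1.
Qed.

(** Each derivative lowers one exponent and multiplies by it, so repeated ones build falling
    factorials. At [m = 0] the factor becomes the factorial of the multiindex [s2m js]. *)
Lemma fps_coef_derivs (js : seq 'I_n) f m :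
  fps_derivs js f m =
    f (m + s2m js)%MM *+ \prod_(i < n) ((m + s2m js)%MM i) ^_ (s2m js i).
Proof.
elim: js m => [|j js IHjs] m /=.
  have -> : s2m [::] = 0%MM :> 'X_{1..n} by apply/mnmP => i; rewrite !mnmE.
  by rewrite addm0 big1 // => i _; rewrite mnm0E ffactn0.
have Ej : s2m (j :: js) = (U_(j) + s2m js)%MM.
  by apply/mnmP => i; rewrite !mnmE.
rewrite IHjs -mulrnA Ej addmA; congr (_ *+ _).
rewrite (bigD1 j) //= [RHS](bigD1 j) //= mulnAC; congr (_ * _)%N.
  rewrite !mnmDE mnm1E eqxx /= add1n ffactnSr.
  by rewrite addnK addn1.
by apply: eq_bigr => i ne_ij; rewrite !mnmDE mnm1E eq_sym (negPf ne_ij) !add0n.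
Qed.

End FpsCoefficients.

(** * Derivatives of the exponential *)

Section FpsExp.
Variables (R : comAlgType rat) (n : nat) (A : fps R n).
Hypothesis A0 : A 0%MM = 0.

(** Powers beyond [mdeg m] contribute nothing because [A] has no constant term. A free bound [d]
    lets coefficients at different monomials share one range of summation. *)
Lemma fps_coef_exp d (m : 'X_{1..n}) : (mdeg m <= d)%N ->
  fps_exp A m = \sum_(k < d.+1) ((k`!)%:R^-1 : rat) *: (A ^+ k) m.
Proof.
move=> le_md; rewrite /= (big_ord_widen d.+1 (fun k => (k`!)%:R^-1 *: (A ^+ k) m)) //.
rewrite [RHS](bigID (fun k : 'I_d.+1 => (k < (mdeg m).+1)%N)) /=.
rewrite [X in _ + X]big1 ?addr0 // => k; rewrite -leqNgt => lt_mk.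
by rewrite fps_coefX_eq0 ?scaler0.
Qed.

Lemma fps_deriv_exp i : fps_deriv i (fps_exp A) = fps_deriv i A * fps_exp A.
Proof.
apply: fpsP => m; pose c k : rat := (k`!)%:R^-1.
(* Termwise differentiation: the constant term drops out, and [k.+1] cancels against [(k.+1)!] to
   leave [1 / k!]. *)
transitivity (\sum_(k < (mdeg m).+1) c k *: (A ^+ k * fps_deriv i A) m).
  rewrite -[LHS]/(fps_exp A (m + U_(i))%MM *+ (m i).+1).
  rewrite (@fps_coef_exp (mdeg m).+1) ?mdegD ?mdeg1 ?addn1 // -sumrMnl.
  rewrite big_ord_recl scalerMnr.
  rewrite -[(A ^+ _) _ *+ _]/(fps_deriv i (A ^+ 0) m) expr0 fps_deriv1.
  rewrite scaler0 add0r; apply: eq_bigr => k _; rewrite lift0 scalerMnr.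
  rewrite -[(A ^+ k.+1) _ *+ _]/(fps_deriv i (A ^+ k.+1) m) fps_derivX.
  rewrite fps_coefMn -scaler_nat scalerA.
  congr (_ *: _); rewrite /c factS natrM invfM mulrAC mulVf ?mul1r //.
  by rewrite Num.Theory.pnatr_eq0.
under eq_bigr => k _ do rewrite mulrC fps_coefM scaler_sumr.
rewrite exchange_big fps_coefM; apply: eq_bigr => ab _.
(* The second factor of every splitting of [m] has degree at most [mdeg m], so the same truncation
   computes all its coefficients. *)
rewrite (fps_coef_exp (bmdeg ab.2)) mulr_sumr.
by apply: eq_bigr => k _; rewrite scalerAr.
Qed.

(** As the second derivatives of [A] along [js] vanish, the product rule never hits the factors
    already produced; each derivative acts on the exponential alone. *)
Lemma fps_derivs_exp (js : seq 'I_n) :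
  (forall j k, j \in js -> k \in js -> fps_deriv j (fps_deriv k A) = 0) ->
  fps_derivs js (fps_exp A) = (\prod_(j <- js) fps_deriv j A) * fps_exp A.
Proof.
elim: js => [|j js IHjs] dA0 /=; first by rewrite big_nil mul1r.
rewrite IHjs => [|k l jk jl]; last by rewrite dA0 // inE (jk, jl) orbT.
rewrite fps_derivM fps_deriv_exp big_seq.
have -> : fps_deriv j (\prod_(k <- js | k \in js) fps_deriv k A) = 0.
  apply: (big_ind (fun h => fps_deriv j h = 0)); first exact: fps_deriv1.
    by move=> g h g0 h0; rewrite fps_derivM g0 h0 mul0r mulr0 addr0.
  by move=> k js_k; rewrite dA0 // inE ?eqxx // js_k orbT.
by rewrite mul0r add0r -big_seq big_cons mulrCA mulrA.
Qed.

End FpsExp.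

(** * Wick sums as permanents, and their values on monomials *)

Section Wick.
Variables (R : comNzRingType) (n : nat).

Lemma wick_perm k (tau1 tau2 : 'I_k -> 'I_n) :
  wick R tau1 tau2 = \sum_(s : 'S_k) \prod_(x < k) (tau2 (s x) == tau1 x)%:R.
Proof.
pose h (s : 'S_k) : {ffun 'I_k -> 'I_k} := [ffun x => s x].
have hB s : bijectiveb (h s).
  by apply/bijectiveP; exists (s^-1)%g => x; rewrite ffunE ?permK ?permKV.
rewrite /wick (reindex h) /=; last first.
  (* Permutations form the subtype of injective finite functions; the default [1] is returned only
     off that subtype. *)
  exists (insubd (1%g : 'S_k)) => [s _|f].
    apply/permP => x; rewrite -[in LHS]pvalE insubdK ?ffunE //.
    by have /andP[] := hB s.
  rewrite inE => /andP[f_inj _]; apply/ffunP => x.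
  by rewrite ffunE -[in LHS]pvalE insubdK.
apply: eq_big => [s|s _]; first by rewrite hB.
by apply: eq_bigr => x _; rewrite ffunE.
Qed.

(** A permutation is recovered from the image of [ord0] and what it does to the other points.
    Injectivity suffices, since both sides have [(k.+1)!] elements. *)
Lemma lift_perm0_bij k :
  bijective (fun p : 'I_k.+1 * 'S_k => lift_perm ord0 p.1 p.2).
Proof.
apply: inj_card_bij => [[y s] [y' s'] /= E|]; last first.
  by rewrite card_prod !card_Sn card_ord factS.
have Ey : y = y' by rewrite -(lift_perm_id ord0 y s) E lift_perm_id.
rewrite -{}Ey in E *; congr (_, _); apply/permP => x; apply: (@lift_inj _ y).
by rewrite -!(lift_perm_lift ord0) E.
Qed.

Lemma card_fiber_lift k (tau : 'I_k.+1 -> 'I_n) y i :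
  #|[pred x | tau x == i]| =
  ((tau y == i) + #|[pred x | tau (lift y x) == i]|)%N.
Proof.
rewrite -!sum1_card big_mkcond [X in (_ + X)%N]big_mkcond /=.
by rewrite (bigD1_ord y) //=.
Qed.

(* The expansion of a permanent along its first row. *)
Lemma wick_expand k (tau1 tau2 : 'I_k.+1 -> 'I_n) :
  wick R tau1 tau2 = \sum_(y | tau2 y == tau1 ord0)
    wick R (tau1 \o lift ord0) (tau2 \o lift y).
Proof.
rewrite wick_perm (reindex _ (onW_bij _ (lift_perm0_bij k))) /=.
rewrite -(pair_bigA _ (fun y s => \prod_x
  (tau2 (lift_perm ord0 y s x) == tau1 x)%:R)) /=.
rewrite [RHS]big_mkcond; apply: eq_bigr => y _; rewrite wick_perm.
under eq_bigr => s _ do rewrite big_ord_recl lift_perm_id.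
case: ifP => _; last by rewrite big1 // => s _; rewrite mul0r.
apply: eq_bigr => s _; rewrite mul1r; apply: eq_bigr => x _.
by rewrite lift_perm_lift.
Qed.

(** Induction by row expansion: exactly [a i0] columns match the first row, and deleting that row
    and any such column lowers the multiplicity of [i0] by one in both maps. The recursion is that
    of the factorial. *)
Lemma wick_fact k (tau1 tau2 : 'I_k -> 'I_n) (a : 'X_{1..n}) :
  (forall i, #|[pred x | tau1 x == i]| = a i) ->
  (forall i, #|[pred x | tau2 x == i]| = a i) ->
  wick R tau1 tau2 = (\prod_(i < n) (a i)`!)%:R.
Proof.
elim: k tau1 tau2 a => [|k IHk] tau1 tau2 a tau1a tau2a.
  have a0 i : a i = 0%N by rewrite -tau1a; apply: eq_card0 => -[].
  rewrite [in RHS]big1 => [|i _]; last by rewrite a0.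
  rewrite wick_perm (big_pred1 (1%g : 'S_0)) ?big_ord0 // => s.
  apply/esym/eqP/permP => -[].
  by [].
pose i0 := tau1 ord0; pose b := (a - U_(i0))%MM.
have bE i : b i = (a i - (i0 == i))%N by rewrite mnmBE mnm1E.
have IH y : tau2 y == i0 -> wick R (tau1 \o lift ord0) (tau2 \o lift y)
    = (\prod_(i < n) (b i)`!)%:R.
  move=> /eqP tau2y; apply: IHk => i; rewrite bE.
    by rewrite -tau1a (card_fiber_lift _ ord0) addKn.
  by rewrite -tau2a (card_fiber_lift _ y) tau2y addKn.
rewrite wick_expand (eq_bigr _ IH) sumr_const tau2a -mulrnA; congr _%:R.
have a_gt0 : (0 < a i0)%N.
  by rewrite -tau1a (card_fiber_lift _ ord0) eqxx.
rewrite [LHS]mulnC (bigD1 i0) //= [RHS](bigD1 i0) //= mulnA bE eqxx.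
congr (_ * _)%N; first by rewrite -{1 3}(prednK a_gt0) factS subn1.
by apply: eq_bigr => i ne_i; rewrite bE eq_sym (negPf ne_i) subn0.
Qed.

Lemma wick_multi_map (a b : 'X_{1..n}) :
  wick R (multi_map a) (multi_map b) =
    if a == b then (\prod_(i < n) (a i)`!)%:R else 0.
Proof.
have cardE (c : 'X_{1..n}) i : #|[pred x | multi_map c x == i]| = c i.
  rewrite -[in RHS](s2mK c) mnmE -sum1_card -sum1_count.
  by rewrite [RHS]big_tnth; apply: eq_bigl => x.
case: eqP => [<-|ne_ab]; first exact: wick_fact.
(* A nonzero summand would be a bijection carrying the fibres of one map onto those of the other,
   forcing equal multiplicities. *)
apply: big1 => s /bijectiveP s_bij; apply/eqP; apply: contra_notT ne_ab => nz.
apply/mnmP => i; rewrite -!cardE -!sum1_card [RHS](reindex _ (onW_bij _ s_bij)) /=.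
apply: eq_bigl => x; rewrite !inE.
have [<-//|ne_x] := eqVneq (multi_map b (s x)) (multi_map a x).
by case/eqP: nz; rewrite (bigD1 x) //= (negPf ne_x) mul0r.
Qed.

End Wick.

(** * The six blocks of exponents *)

Lemma ord6_ind (P : 'I_6 -> Prop) :
  P i_sbar -> P i_s -> P i_tbar -> P i_t -> P i_ubar -> P i_u -> forall r, P r.
Proof.
move=> P0 P1 P2 P3 P4 P5 [[|[|[|[|[|[|k]]]]]] lt_k] //;
  rewrite (bool_irrelevance lt_k isT); assumption.
Qed.

Section Blocks.
Variable n : nat.
Implicit Types (a b : 'X_{1..n}) (m : 'X_{1..6 * n}) (r : 'I_6).

(** A section of [block r] whose image has all other blocks zero; each monomial is the sum of the
    embeddings of its six blocks. *)
Definition embed r a : 'X_{1..6 * n} := (\sum_(l < n) U_(gidx r l) *+ a l)%MM.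

Lemma eq_gidx r r' (l l' : 'I_n) :
  (gidx r l == gidx r' l') = (r == r') && (l == l').
Proof.
by rewrite (inj_eq (@cast_ord_inj _ _ _)) (inj_eq enum_rank_inj) xpair_eqE.
Qed.

Lemma big_gidx (T : Type) (idx : T) (op : Monoid.com_law idx) (D : 'I_(6 * n) -> T) :
  \big[op/idx]_j D j = \big[op/idx]_(r < 6) \big[op/idx]_(l < n) D (gidx r l).
Proof.
rewrite (reindex _ (curry_mxvec_bij _ _)) pair_bigA /=.
by apply: eq_bigr => -[].
Qed.

Lemma blockE r m l : block r m l = m (gidx r l). Proof. exact: mnmE. Qed.

Lemma eq_block m m' : (forall r, block r m = block r m') -> m = m'.
Proof.
by move=> E; apply/mnmP; case/mxvec_indexP => r l; rewrite -!blockE E.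
Qed.

Lemma blockD r m m' : block r (m + m')%MM = (block r m + block r m')%MM.
Proof. by apply/mnmP => l; rewrite !(blockE, mnmDE). Qed.

Lemma block_embed r r' a : block r (embed r' a) = if r == r' then a else 0%MM.
Proof.
apply/mnmP => l; rewrite blockE mnm_sumE; case: eqP => [->|/eqP ne_r].
  rewrite (bigD1 l) //= big1 ?addn0 => [|l' ne_l].
    by rewrite mulmnE mnm1E eqxx mul1n.
  by rewrite mulmnE mnm1E eq_gidx eqxx (negPf ne_l).
by rewrite mnm0E big1 // => l' _; rewrite mulmnE mnm1E eq_gidx eq_sym (negPf ne_r).
Qed.

Lemma mdeg_embed r a : mdeg (embed r a) = mdeg a.
Proof.
by rewrite mdeg_sum mdegE; apply: eq_bigr => l _; rewrite mdegMn mdeg1 mul1n.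
Qed.

Lemma mdeg_block r m : (mdeg (block r m) <= mdeg m)%N.
Proof.
rewrite !mdegE big_gidx (bigD1 r) //=.
by under eq_bigr => l _ do rewrite blockE; rewrite leq_addr.
Qed.

Lemma embed_U r l : embed r U_(l) = U_(gidx r l)%MM.
Proof.
apply: eq_block => r'; rewrite block_embed; apply/mnmP => l'.
rewrite blockE mnm1E eq_gidx [r == _]eq_sym.
by case: eqP; rewrite ?mnm0E ?mnm1E.
Qed.

End Blocks.

Lemma prod_s2m (R : comPzSemiRingType) (n : nat) (js : seq 'I_n) (D : 'I_n -> R) :
  \prod_(k <- js) D k = \prod_(l < n) D l ^+ s2m js l.
Proof.
elim: js => [|k js IHjs]; first by rewrite big_nil big1 // => l _; rewrite mnmE.
rewrite big_cons IHjs; under [RHS]eq_bigr => l _ do rewrite mnmE /= exprD.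
rewrite big_split /=; congr (_ * _); last by apply: eq_bigr => l _; rewrite mnmE.
rewrite (bigD1 k) //= eqxx expr1 big1 ?mulr1 // => l /negPf ne_l.
by rewrite eq_sym ne_l.
Qed.

(** * Series in the indeterminates of a single block *)

Section BlockSubst.
Variables (R : comNzRingType) (n : nat).
Implicit Types (f g : fps R n) (m : 'X_{1..6 * n}) (r : 'I_6).

Definition block_subst r f : fps R (6 * n) :=
  fps_subst f (fun l => fpsX (gidx r l)).

Lemma prod_gidxX r (a : 'X_{1..n}) :
  \prod_(l < n) (fpsX (gidx r l) : fps R (6 * n)) ^+ a l = fps_monom R (embed r a).
Proof.
by rewrite fps_monom_sum; apply: eq_bigr => l _; rewrite fps_monom_muln.
Qed.

(** Substituting indeterminates only relabels monomials: [a] becomes [embed r a], and a monomial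
    involving another block gets coefficient zero. *)
Lemma coef_block_subst r f m : block_subst r f m =
  if m == embed r (block r m) then f (block r m) else 0.
Proof.
rewrite /=; under eq_bigr => a _ do rewrite prod_gidxX /=.
case: eqP => [Em|ne_m].
  have lt_b : (mdeg (block r m) < (mdeg m).+1)%N by rewrite ltnS mdeg_block.
  rewrite (bigD1 (BMultinom lt_b)) //= -Em eqxx mulr1 big1 ?addr0 // => a ne_a.
  case: eqP => [Ema|]; last by rewrite mulr0.
  by case/eqP: ne_a; apply: val_inj; rewrite /= (congr1 (block r) Ema) block_embed eqxx.
rewrite big1 // => a _; case: eqP => [Ema|]; last by rewrite mulr0.
by case: ne_m; rewrite {2}Ema block_embed eqxx.
Qed.

(** The polynomial counterpart of [coef_block_subst]; there the substitution is already known to be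
    a ring morphism. *)
Lemma coef_comp_block r (p : {mpoly R[n]}) m :
  (p \mPo [tuple 'X_(gidx r l) | l < n])@_m =
  if m == embed r (block r m) then p@_(block r m) else 0.
Proof.
have XE a : 'X_[a] \mPo [tuple 'X_(gidx r l) | l < n] = 'X_[R, embed r a].
  rewrite comp_mpolyX /embed -mprodXnE.
  by apply: eq_bigr => l _; rewrite tnth_mktuple.
rewrite comp_mpolyEX raddf_sum /=.
under eq_bigr => a _ do rewrite XE mcoeffZ mcoeffX.
case: eqP => [Em|ne_m]; last first.
  rewrite big1 // => a _; case: eqP => [Ema|]; last by rewrite mulr0.
  by case: ne_m; rewrite -{2}Ema block_embed eqxx.
have Ea a : (embed r a == m) = (a == block r m).
  by apply/eqP/eqP => [<-|->//]; rewrite block_embed eqxx.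
under eq_bigr => a _ do rewrite Ea.
have [supp|nsupp] := boolP (block r m \in msupp p).
  rewrite (bigD1_seq (block r m)) //= eqxx mulr1 big1 ?addr0 // => a ne_a.
  by rewrite (negPf ne_a) mulr0.
rewrite (memN_msupp_eq0 nsupp) big_seq big1 // => a supp_a.
by case: eqP supp_a nsupp => [->->//|_ _ _]; rewrite mulr0.
Qed.

Lemma block_substM r f g :
  block_subst r (f * g) = block_subst r f * block_subst r g.
Proof.
apply: fpsP => m; pose X := [tuple 'X_(gidx r l) : {mpoly R[6 * n]} | l < n].
(* Truncation at the degree of [m] is harmless, since a block of [k] has degree at most that of
   [k]. *)
have truncE h k : (mdeg k <= mdeg m)%N ->
    block_subst r h k = (fps_trunc (mdeg m).+1 h \mPo X)@_k.
  move=> le_k; rewrite coef_block_subst coef_comp_block mcoeff_fps_trunc //.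
  by rewrite ltnS (leq_trans (mdeg_block r k)).
rewrite coef_block_subst (fps_coefM_mpoly (truncE f) (truncE g)).
rewrite -[(_ \mPo X) * _]rmorphM coef_comp_block; case: ifP => // _.
by apply: fps_coefM_mpoly => k le_k; rewrite mcoeff_fps_trunc // ltnS
  (leq_trans le_k (mdeg_block r m)).
Qed.

Lemma block_subst1 r : block_subst r 1 = 1.
Proof.
apply: fpsP => m; rewrite coef_block_subst !fps_coef1.
have e0 : embed r 0%MM = 0%MM :> 'X_{1..6 * n}.
  by apply/eqP; rewrite -mdeg_eq0 mdeg_embed mdeg0.
have b0 : block r 0%MM = 0%MM :> 'X_{1..n} by rewrite -e0 block_embed eqxx.
have [->|nz_m] := eqVneq m 0%MM; first by rewrite b0 e0 !eqxx.
case: eqP => // Em; case: eqP => // b_m.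
by case/eqP: nz_m; rewrite Em b_m e0.
Qed.

Lemma block_subst_monom r (D : 'I_n -> fps R n) (a : 'X_{1..n}) :
  block_subst r (\prod_(l < n) D l ^+ a l) =
  \prod_(l < n) block_subst r (D l) ^+ a l.
Proof.
rewrite (big_morph _ (block_substM r) (block_subst1 r)); apply: eq_bigr => l _.
by elim: (a l) => [|k IHk]; rewrite ?expr0 ?block_subst1 // !exprS block_substM IHk.
Qed.

Lemma deriv_block_subst r r' l f : r != r' ->
  fps_deriv (gidx r l) (block_subst r' f) = 0.
Proof.
move=> ne_r; apply: fpsP => m.
rewrite -[LHS]/(block_subst r' f (m + U_(gidx r l))%MM *+ (m (gidx r l)).+1).
rewrite coef_block_subst; case: eqP => [Em|_]; last by rewrite mul0rn.
have := congr1 (fun k => block r k l) Em; rewrite block_embed (negPf ne_r).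
by rewrite mnm0E blockE mnmDE mnm1E eqxx addn1.
Qed.

(** Serves both halves of the exponent: a bar derivative extracts the matching coefficient from its
    own half and kills the other half. *)
Lemma deriv_linear_block r r1 r2 l (D : 'I_n -> fps R n) : r != r2 ->
  fps_deriv (gidx r l) (\sum_k fpsX (gidx r1 k) * block_subst r2 (D k)) =
  if r == r1 then block_subst r2 (D l) else 0.
Proof.
move=> ne_r; rewrite fps_deriv_sum.
under eq_bigr => k _ do
  rewrite fps_derivM deriv_block_subst // mulr0 addr0 fps_deriv_fpsX eq_gidx.
rewrite [r1 == r]eq_sym; case: eqP => _; last by rewrite big1 // => k; rewrite mul0r.
by rewrite (bigD1 l) //= eqxx mul1r big1 ?addr0 // => k /negPf->; rewrite mul0r.
Qed.

(** The two factors involve disjoint sets of indeterminates, so a monomial splits between their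
    supports in at most one way. *)
Lemma coef_block_substM r r' f g m : r != r' ->
  (block_subst r f * block_subst r' g) m =
  if m == (embed r (block r m) + embed r' (block r' m))%MM
  then f (block r m) * g (block r' m) else 0.
Proof.
move=> ne_r; have blocks (a b : 'X_{1..n}) :
    block r (embed r a + embed r' b) = a /\ block r' (embed r a + embed r' b) = b.
  by rewrite !blockD !block_embed !eqxx [r' == r]eq_sym (negPf ne_r) addm0 add0m.
case: eqP => [Em|ne_m].
  rewrite {1}Em fps_coefM_unique_split; first
    by rewrite !coef_block_subst !block_embed !eqxx.
  move=> a b; rewrite -Em => Em' ne_a; rewrite !coef_block_subst.
  case: eqP => [Ea|]; last by rewrite mul0r.
  case: eqP => [Eb|]; last by rewrite mulr0.
  case/eqP: ne_a; rewrite {1}Ea; congr embed.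
  by rewrite Em' blockD Eb block_embed (negPf ne_r) addm0.
apply: fps_coefM_split0 => a b Em; rewrite !coef_block_subst.
case: eqP => [Ea|]; last by rewrite mul0r.
case: eqP => [Eb|]; last by rewrite mulr0.
case: ne_m; rewrite Em Ea Eb.
by have [-> ->] := blocks (block r a) (block r' b).
Qed.

End BlockSubst.

(** * The exponent and the coefficients of its exponential *)

Lemma big_ord6 (T : Type) (idx : T) (op : Monoid.law idx) (D : 'I_6 -> T) :
  \big[op/idx]_(r < 6) D r = op (D i_sbar) (op (D i_s) (op (D i_tbar)
    (op (D i_t) (op (D i_ubar) (D i_u))))).
Proof.
rewrite !big_ord_recl big_ord0 Monoid.mulm1.
by congr (op (D _) (op (D _) (op (D _) (op (D _) (op (D _) (D _))))));
  apply: val_inj.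
Qed.

Section ActionExponential.
Variables (R : comAlgType rat) (n : nat) (F G : 'I_n -> fps R n).

Definition action : fps R (6 * n) :=
  \sum_(l < n) fpsX (gidx i_sbar l) * block_subst i_t (F l) +
  \sum_(l < n) fpsX (gidx i_tbar l) * block_subst i_u (G l).

Lemma action_no_bar (m : 'X_{1..6 * n}) :
  block i_sbar m = 0%MM -> block i_tbar m = 0%MM -> action m = 0.
Proof.
have sum0 r r' (D : 'I_n -> fps R n) : block r m = 0%MM ->
    (\sum_(l < n) fpsX (gidx r l) * block_subst r' (D l)) m = 0.
  move=> m0; rewrite fps_coef_sum big1 // => l _.
  rewrite -[fpsX _]/(fps_monom R U_(gidx r l)%MM) fps_monomM lep1mP.
  by rewrite -blockE m0 mnm0E.
by move=> ms mt; rewrite fps_coefD !sum0 ?addr0.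
Qed.

Lemma action0 : action 0%MM = 0.
Proof. by apply: action_no_bar; apply/mnmP => l; rewrite blockE !mnm0E. Qed.

Lemma exp_action_no_bar (m : 'X_{1..6 * n}) :
  block i_sbar m = 0%MM -> block i_tbar m = 0%MM ->
  fps_exp action m = (m == 0%MM)%:R.
Proof.
move=> ms mt; rewrite (fps_coef_exp action0 (leqnn _)) big_ord_recl.
rewrite expr0 fps_coef1 invr1 scale1r big1 ?addr0 // => k _.
rewrite lift0; move: (k : nat) => {}k.
(* A positive power contains a factor [action], and a divisor [a] of a monomial without bars has no
   bars either. *)
rewrite exprS fps_coefM_split0 ?scaler0 // => a b Em.
move: ms mt; rewrite Em !blockD => /eqP + /eqP.
rewrite !mnmD_eq0 => /andP[/eqP as0 _] /andP[/eqP at0 _].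
by rewrite action_no_bar ?mul0r.
Qed.

Lemma deriv_action_sbar l :
  fps_deriv (gidx i_sbar l) action = block_subst i_t (F l).
Proof. by rewrite fps_derivD !deriv_linear_block //= addr0. Qed.

Lemma deriv_action_tbar l :
  fps_deriv (gidx i_tbar l) action = block_subst i_u (G l).
Proof. by rewrite fps_derivD !deriv_linear_block //= add0r. Qed.

(** Both sides compute one coefficient of the derivative of the exponential along all bars of [m].
    Keeping the factorials as multipliers avoids division; the Gaussian weight supplies them
    later. *)
Lemma coef_exp_action (m : 'X_{1..6 * n}) :
  fps_exp action m *+ (\prod_(l < n) (block i_sbar m l)`! *
                       \prod_(l < n) (block i_tbar m l)`!) =
  if (block i_s m == 0%MM) && (block i_ubar m == 0%MM) then
    (\prod_(l < n) F l ^+ block i_sbar m l) (block i_t m) *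
    (\prod_(l < n) G l ^+ block i_tbar m l) (block i_u m)
  else 0.
Proof.
set alpha := block i_sbar m; set beta := block i_tbar m.
(* [B] is the bar part of [m], along which to differentiate; [m'] is the rest, at which the
   derivative is read. *)
pose B := (embed i_sbar alpha + embed i_tbar beta)%MM.
pose m' := (embed i_s (block i_s m) + embed i_t (block i_t m) +
  embed i_ubar (block i_ubar m) + embed i_u (block i_u m))%MM.
have Em : m = (m' + B)%MM.
  by apply: eq_block; apply: ord6_ind;
    rewrite !blockD !block_embed /= ?add0m ?addm0.
have B_bar j : j \in m2s B -> exists l, j = gidx i_sbar l \/ j = gidx i_tbar l.
  rewrite -has_pred1 has_count -[count _ _]/(count_mem j (m2s B)).
  have -> : count_mem j (m2s B) = B j by rewrite -[in RHS](s2mK B) mnmE.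
  case/mxvec_indexP: j => r l; rewrite -[mxvec_index r l]/(gidx r l) -blockE.
  rewrite blockD !block_embed; move: r.
  by apply: ord6_ind; rewrite /= ?addm0 ?mnm0E //; exists l; [left|right].
have dA0 j k : j \in m2s B -> k \in m2s B ->
    fps_deriv j (fps_deriv k action) = 0.
  move=> /B_bar[l [->|->]] /B_bar[l' [->|->]];
    by rewrite ?deriv_action_sbar ?deriv_action_tbar deriv_block_subst.
have BE r l : B (gidx r l) =
    ((if r == i_sbar then alpha else 0) + (if r == i_tbar then beta else 0))%MM l.
  by rewrite -blockE blockD !block_embed.
have mE l : m (gidx i_sbar l) = alpha l /\ m (gidx i_tbar l) = beta l.
  by rewrite -!blockE.
(* In the two bar blocks [m' + B] agrees with [B], giving full factorials; elsewhere [B] is zero and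
   the falling factorials are [1]. *)
have factE : (\prod_(j < 6 * n) ((m' + B)%MM j) ^_ (B j) =
    \prod_(l < n) (alpha l)`! * \prod_(l < n) (beta l)`!)%N.
  rewrite -Em big_gidx big_ord6 /=.
  rewrite [X in (_ * (X * _))%N]big1 ?[X in (_ * (_ * (_ * (X * _))))%N]big1
    ?[X in (_ * (_ * (_ * (_ * (X * _)))))%N]big1
    ?[X in (_ * (_ * (_ * (_ * (_ * X)))))%N]big1 => [|l _|l _|l _|l _];
    rewrite ?BE /= ?addm0 ?mnm0E ?ffactn0 // !mul1n !muln1.
  by congr (_ * _)%N; apply: eq_bigr => l _; have [m_s m_t] := mE l;
    rewrite BE /= ?addm0 ?add0m ?m_s ?m_t ffactnn.
have prodE : \prod_(j <- m2s B) fps_deriv j action =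
    block_subst i_t (\prod_(l < n) F l ^+ alpha l) *
    block_subst i_u (\prod_(l < n) G l ^+ beta l).
  rewrite prod_s2m s2mK big_gidx big_ord6 /=.
  rewrite [X in _ * (X * _)]big1 ?[X in _ * (_ * (_ * (X * _)))]big1
    ?[X in _ * (_ * (_ * (_ * (X * _))))]big1
    ?[X in _ * (_ * (_ * (_ * (_ * X))))]big1 => [|l _|l _|l _|l _];
    rewrite ?BE /= ?addm0 ?mnm0E ?expr0 // !mul1r !mulr1 !block_subst_monom.
  by congr (_ * _); apply: eq_bigr => l _;
    rewrite BE /= ?addm0 ?add0m ?deriv_action_sbar ?deriv_action_tbar.
transitivity (fps_derivs (m2s B) (fps_exp action) m').
  by rewrite fps_coef_derivs s2mK -Em -factE -Em.
rewrite fps_derivs_exp ?action0 // prodE.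
set P := block_subst i_t _ * _; transitivity (P m').
  (* Every divisor of [m'] is free of bars, and on such monomials the exponential has the same
     coefficients as [1]. *)
  rewrite -[in RHS](mulr1 P); apply: eq_fps_coefM => a b Em'.
  have m'0 r : (r == i_sbar) || (r == i_tbar) -> block r m' = 0%MM.
    by move: r; apply: ord6_ind; rewrite // !blockD !block_embed /= ?addm0.
  have /eqP := m'0 i_sbar isT; have /eqP := m'0 i_tbar isT.
  rewrite Em' !blockD !mnmD_eq0 => /andP[_ /eqP bt] /andP[_ /eqP bs].
  by rewrite exp_action_no_bar // fps_coef1.
have bl r : block r m' = if (r == i_sbar) || (r == i_tbar) then 0%MM else block r m.
  by move: r; apply: ord6_ind; rewrite !blockD !block_embed /= ?addm0 ?add0m.
(* [P] involves only [t] and [u], so its coefficient at [m'] can survive only when the [s] and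
   [ubar] blocks vanish. *)
rewrite /P coef_block_substM // !bl /=; case: eqP => [Em'|ne_m'].
  have := bl i_s; have := bl i_ubar; rewrite {1 2}Em' !blockD !block_embed /= !addm0.
  by move=> <- <-; rewrite !eqxx.
case: ifP => // /andP[/eqP ms /eqP mu]; case: ne_m'; rewrite /m' ms mu.
by apply: eq_block; apply: ord6_ind; rewrite !blockD !block_embed /= ?addm0 ?add0m.
Qed.

End ActionExponential.

(** * The nonzero terms of the Gaussian integral *)

Section Integrand.
Variables (R : comAlgType rat) (n : nat) (F G : 'I_n -> fps R n).
Variables (i : 'I_n) (J : 'X_{1..n}).

(** The candidates for a nonzero term: paired blocks agree, with [i] and [J] imposed by the
    prefactor and [beta] free. *)
Definition diag_monom (beta : 'X_{1..n}) : 'X_{1..6 * n} :=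
  (embed i_sbar U_(i) + embed i_s U_(i) + embed i_tbar beta + embed i_t beta +
   embed i_ubar J + embed i_u J)%MM.

Definition integrand : fps R (6 * n) :=
  fps_monom R (embed i_s U_(i) + embed i_ubar J) * fps_exp (action F G).

(** The Wick weight is the product of the factorials of [U_(i)], [beta] and [J]. The first two are
    those required by [coef_exp_action]; only that of [J] remains. *)
Lemma gauss_term_diag (beta : 'X_{1..n}) :
  gauss_term integrand (diag_monom beta) =
  F i beta * (\prod_(l < n) G l ^+ beta l) J *+ \prod_(l < n) (J l)`!.
Proof.
pose rest := (embed i_sbar U_(i) + embed i_tbar beta + embed i_t beta + embed i_u J)%MM.
have Em : diag_monom beta = (rest + (embed i_s U_(i) + embed i_ubar J))%MM.
  by apply: eq_block; apply: ord6_ind; rewrite !blockD !block_embed /= ?addm0 ?add0m.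
rewrite /gauss_term /gauss_monomial gaussI_wick !wick_multi_map.
rewrite fps_monomM Em lem_addl addmK -Em !blockD !block_embed /= !addm0 !add0m !eqxx.
rewrite -!natrM mulr_natr mulrnA; congr (_ *+ _).
have := coef_exp_action F G rest.
rewrite !blockD !block_embed /= ?addm0 ?add0m !eqxx /= => ->; congr (_ * _).
rewrite (_ : \prod_l _ = F i) // (bigD1 i) //= mnm1E eqxx expr1 big1 ?mulr1 //.
by move=> l /negPf ne_l; rewrite mnm1E eq_sym ne_l.
Qed.

(** The Wick weight forces paired blocks to agree. Once the prefactor is divided out,
    [coef_exp_action] leaves no [s] or [ubar], so these blocks of [m] are exactly [U_(i)] and
    [J]. *)
Lemma gauss_term_neq0 (m : 'X_{1..6 * n}) :
  gauss_term integrand m != 0 -> m = diag_monom (block i_tbar m).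
Proof.
rewrite /gauss_term /gauss_monomial gaussI_wick !wick_multi_map fps_monomM.
case: ifP => [le_m|_]; last by rewrite mul0r eqxx.
case: (block i_sbar m =P _) => [Es|_]; last by rewrite !(mul0r, mulr0) eqxx.
case: (block i_tbar m =P _) => [Et|_]; last by rewrite !(mul0r, mulr0) eqxx.
case: (block i_ubar m =P _) => [Eu|_]; last by rewrite !mulr0 eqxx.
set m' := (m - _)%MM; have Em : m = (m' + (embed i_s U_(i) + embed i_ubar J))%MM.
  by rewrite submK.
rewrite -!natrM mulr_natr mulrnA.
have [E1 E2] : block i_sbar m = block i_sbar m' /\ block i_tbar m = block i_tbar m'.
  by rewrite Em !blockD !block_embed /= !addm0.
rewrite E1 E2 coef_exp_action.
case: ifP => [/andP[/eqP s0 /eqP u0] _|]; last by rewrite mul0rn eqxx.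
have Es' : block i_s m = U_(i)%MM.
  by rewrite Em !blockD !block_embed /= s0 add0m addm0.
have Eu' : block i_ubar m = J by rewrite Em !blockD !block_embed /= u0 !add0m.
apply: eq_block; apply: ord6_ind; rewrite !blockD !block_embed /= ?addm0 ?add0m //.
- by rewrite Es.
- by rewrite -E2 -Et.
- by rewrite -Eu.
Qed.

End Integrand.

Theorem theorem2 (R : comAlgType rat) (n : nat) (n_ge1 : (1 <= n)%N)
    (F G : 'I_n -> fps R n)
    (F0 : forall l : 'I_n, F l 0%MM = 0)
    (G0 : forall l : 'I_n, G l 0%MM = 0)
    (d : nat) (d_ge1 : (1 <= d)%N) (i : 'I_n) (j : d.-tuple 'I_n) :
  is_gauss_integral
    (v_s R i * (\prod_(k < d) v_ubar R (tnth j k)) *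
     fps_exp (\sum_(l < n) v_sbar R l * fps_subst (F l) (v_t R) +
              \sum_(l < n) v_tbar R l * fps_subst (G l) (v_u R)))
    (fps_derivs j (fps_subst (F i) G) 0%MM).
Proof.
set J := s2m j; set U := _ * fps_exp _.
have -> : U = integrand F G i J.
  rewrite /U -[X in fps_exp X]/(action F G); congr (_ * _).
  rewrite fps_monomD embed_U; congr (_ * _).
  by rewrite -prod_gidxX -prod_s2m big_tuple.
(* The bound on the degree of [beta] is the one in [fps_subst] for the coefficient at [J]. *)
pose S := [seq diag_monom i J (val b) | b : 'X_{1..n < (mdeg J).+1}].
have tbarK b : block i_tbar (diag_monom i J b) = b.
  by rewrite !blockD !block_embed /= ?addm0 ?add0m.
exists S; split.
- rewrite map_inj_uniq ?enum_uniq // => b b' E; apply: val_inj.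
  by rewrite -[LHS]tbarK E tbarK.
- move=> m nz_m; have Em := gauss_term_neq0 nz_m.
  move: nz_m; rewrite Em gauss_term_diag => nz_m.
  have lt_b : (mdeg (block i_tbar m) < (mdeg J).+1)%N.
    (* Since the [G l] have no constant term, a product of more than [mdeg J] of them has no term at
       [J]. *)
    rewrite ltnS leqNgt; apply: contra nz_m => lt_J.
    by rewrite fps_coef_prodX_eq0 // mulr0 mul0rn.
  by apply/imageP; exists (BMultinom lt_b).
- rewrite big_map big_enum /=; under eq_bigr => b _ do rewrite gauss_term_diag.
  (* The sum over [b] is by definition the coefficient of [fps_subst (F i) G] at [J]; only the two
     factorial multipliers remain to be compared. *)
  rewrite sumrMnl fps_coef_derivs add0m; congr (_ *+ _).
  by apply: eq_bigr => l _; rewrite ffactnn.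
Qed.
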